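(* There is an absolute constant $c$ such that, for all integers $r\ge 2$, $d\ge 1$ and $s_{1},\ldots,s_{r}\ge 1$, writing $\boldsymbol{s}=(s_{1},\ldots,s_{r})$, $$f_{r}(d,s_{1},\ldots,s_{r})\le c\,d\,r\,T_{d,r}(\boldsymbol{s})\log\bigl(e\,r\,T_{d,r}(\boldsymbol{s})\bigr).$$
   Context: A set in $\mathbb{R}^{d}$ is called $s$-convex if it is a union of at most $s$ convex sets. For integers $r\ge 2$, $d\ge 1$ and $s_{1},\ldots,s_{r}\ge 1$, let $f_{r}(d,s_{1},\ldots,s_{r})$ be the least integer $N$ with the following property: whenever $P\subseteq\mathbb{R}^{d}$ is finite and $|P|\ge N$, there is a partition $P=P_{1}\sqcup\cdots\sqcup P_{r}$ into nonempty parts such that every choice of $s_{i}$-convex sets $C_{i}\supseteq P_{i}$, $i\in[r]=\{1,\ldots,r\}$, satisfies $\bigcap_{i=1}^{r}C_{i}\ne\emptyset$. Put $S(\boldsymbol{s})=\prod_{i=1}^{r}s_{i}$, $q=\min\{r,d+1\}$, $$H_{d,r}(\boldsymbol{s})=\sum_{\emptyset\ne I\subseteq[r],\ |I|\le d+1}|I|\prod_{i\in I}s_{i},\qquad T_{d,r}(\boldsymbol{s})=\min\{q\,S(\boldsymbol{s}),\,H_{d,r}(\boldsymbol{s})\}.$$ Here $\log$ is the natural logarithm and $e$ its base. *)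

(* Defs.v *)
From mathcomp Require Import all_boot all_order all_algebra.
From mathcomp Require Import boolp classical_sets cardinality reals sequences convex exp.

Set Implicit Arguments.
Unset Strict Implicit.
Unset Printing Implicit Defensive.

Local Open Scope classical_set_scope.

(* The empty set is convex and the A i may coincide, so indexing by 'I_s
   amounts to a union of at most s convex sets. *)
Definition s_convex (R : realType) (d s : nat) (C : set 'rV[R]_d) : Prop :=
  exists A : 'I_s -> set 'rV[R]_d,
    (forall i, convex_set (M := 'rV[R]_d) (A i)) /\ C = \bigcup_i A i.

Definition tverberg_partition (R : realType) (r d : nat) (s : 'I_r -> nat)
    (P : set 'rV[R]_d) (Q : 'I_r -> set 'rV[R]_d) : Prop :=
  classical_sets.partition setT Q P /\
  forall C : 'I_r -> set 'rV[R]_d,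
    (forall i, s_convex (s i) (C i) /\ Q i `<=` C i) ->
    \bigcap_i C i !=set0.

Definition tverberg_threshold (R : realType) (r d : nat) (s : 'I_r -> nat)
    (N : nat) : Prop :=
  forall P : set 'rV[R]_d, finite_set P -> (`I_N #<= P)%card ->
    exists Q : 'I_r -> set 'rV[R]_d, tverberg_partition s P Q.

(* f_r(d, s_1, ..., s_r) = N.  Restricting N to natural numbers loses nothing:
   for r > 0 the empty P has no partition into r nonempty parts, so no integer
   N <= 0 has the property. *)
Definition is_tverberg_number (R : realType) (r d : nat) (s : 'I_r -> nat)
    (N : nat) : Prop :=
  tverberg_threshold R d s N /\
  forall M : nat, tverberg_threshold R d s M -> N <= M.

Definition Sprod (r : nat) (s : 'I_r -> nat) : nat := \prod_(i < r) s i.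

Definition Hsum (d r : nat) (s : 'I_r -> nat) : nat :=
  \sum_(I : {set 'I_r} | (I != finset.set0) && (#|I| <= d.+1))
    #|I| * \prod_(i in I) s i.

Definition Tmin (d r : nat) (s : 'I_r -> nat) : nat :=
  minn (minn r d.+1 * Sprod s) (Hsum d s).

(* Main.v *)
Require Import Defs.
From mathcomp Require Import all_boot all_order all_algebra.
From mathcomp Require Import boolp classical_sets cardinality reals sequences convex exp.
From HB Require Import structures.
From mathcomp Require Import interval_inference fintype finset finmap ring lra.

Set Implicit Arguments.
Unset Strict Implicit.
Unset Printing Implicit Defensive.

Import Order.TTheory GRing.Theory Num.Theory.

(** The proof is a counting argument over all colourings [chi : P -> 'I_r].
    Let [n] be the number of points.  A colouring whose classes are not a
    Tverberg partition comes with convex sets [A i a], [a < s i], such that the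
    unions over [a] cover the colour classes and have no common point.  Hence
    [A 0 (j 0), ..., A r.-1 (j r.-1)] have empty intersection for every tuple
    [j], and it is enough to remember a witness of this for every [j].

    By linear programming duality (a Farkas lemma) together with the conical
    Caratheodory theorem, such a witness consists of at most [d.+1] indices [i]
    and, for each of them, a closed halfspace containing the points of
    [A i (j i)], the chosen halfspaces having no common point
    ([hulls_meet_or_separated]).  Only the traces of these halfspaces on the
    finite point set matter, and there are few traces: halfspaces of
    ['rV_d] shatter no set of more than [d.+1] points, so that Pajor's form of
    the Sauer-Shelah lemma leaves at most [(e n / d.+1) ^ d.+1] of them
    when [n >= d.+1] ([card_halfspace_traces]).

    The witnesses fill a list of slots, and there are two economical ways to
    organise it.  One gives every tuple [j] its own [minn r d.+1] slots, each
    holding an index and a trace ([full_tuple_bound]).  The other one attaches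
    the witness to the restriction of [j] to its index set [I], so that tuples
    with the same restriction share it; a slot is then a partial tuple with
    small domain together with an element of the domain
    ([partial_tuple_bound]).  The numbers of slots are the two terms of the
    minimum [T = Tmin d s].

    The slots determine regions [D i] of the point set which contain the colour
    classes and have empty intersection.  Every point misses one of the regions,
    so at most [r.-1 ^ n] colourings are compatible with given regions.  If all
    colourings failed, then [r ^ n <= (r * F) ^ T * r.-1 ^ n], where [F] is the
    number of traces; taking logarithms, this bounds [n / (d + 1)] by
    [r T (1 + ln r + ln (n / (d + 1)))] and hence [n] by a multiple of
    [d r T ln (e r T)] ([threshold_numerics]). *)

Local Open Scope ring_scope.

(** * Conical hulls and linear separation *)

Lemma exists_neg_functional (R : realFieldType) (V : vectType R) (w : V) :
  w != 0 -> exists y : 'Hom(V, R^o), y w < 0.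
Proof.
move=> w0; set b := vbasis {:V}.
have [i ci0] : exists i, coord b i w != 0.
  apply/existsP; apply: contraNT w0 => /existsPn c0.
  rewrite (coord_vbasis (memvf w)) big1// => i _.
  by have /negPn/eqP -> := c0 i; rewrite scale0r.
exists (- coord b i w *: linfun (coord b i : {linear V -> R^o})).
rewrite scale_lfunE lfunE/= scaleNr oppr_lt0 /GRing.scale/=.
by rewrite -expr2 exprn_even_gt0.
Qed.

(** The next four identities are linearity, restated with products of [R]
    instead of the scaling of the module [R^o], on which the ring lemmas do not
    apply syntactically. *)
Lemma lfun_subZ (R : realFieldType) (V : vectType R) (y : 'Hom(V, R^o)) a u v :
  y (u - a *: v) = y u - a * y v :> R.
Proof. by rewrite linearB linearZ. Qed.

Lemma lfun_combination (R : realFieldType) (V : vectType R) (J : finType) (y : 'Hom(V, R^o))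
    (P : pred J) (mu : J -> R) (v : J -> V) :
  y (\sum_(j | P j) mu j *: v j) = \sum_(j | P j) mu j * y (v j) :> R.
Proof. by rewrite linear_sum; apply: eq_bigr => j _; rewrite linearZ. Qed.

Lemma lfunZ (R : realFieldType) (V : vectType R) (y : 'Hom(V, R^o)) a v :
  y (a *: v) = a * y v :> R.
Proof. by rewrite linearZ. Qed.

Lemma subZ_lfunE (R : realFieldType) (V : vectType R) (y z : 'Hom(V, R^o)) a v :
  (z - a *: y) v = z v - a * y v :> R.
Proof. by rewrite add_lfunE opp_lfunE scale_lfunE. Qed.

(** Farkas' lemma and the conical Caratheodory theorem come from one induction on
    the number of generators.  If a functional [y] separates [w] from all
    generators but [v m], and fails at [v m], then everything can be projected
    along [v m] onto the hyperplane [y = 0]: a separating functional for the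
    projections lifts back, and a conical combination for them lifts by adding
    a multiple of [v m].  In the latter case one generator is gained, but the
    dimension of the ambient space [U] dropped by one, which gives the bound on
    the number of generators.  The subspace [U] is a parameter for this reason. *)
Lemma conic_caratheodory_farkas (R : realFieldType) (V : vectType R) (J : finType)
    (v : J -> V) (S : {set J}) (U : {vspace V}) (w : V) :
  {in S, forall j, v j \in U} -> w \in U ->
  (exists I : {set J}, exists mu : J -> R,
      [/\ I \subset S, (#|I| <= \dim U)%N, forall j, 0 <= mu j &
          w = \sum_(j in I) mu j *: v j])
  \/ exists2 y : 'Hom(V, R^o), {in S, forall j, 0 <= y (v j)} & y w < 0.
Proof.
have [n leSn] := ubnP #|S|; elim: n => // n IHn in v S U w leSn *.
move=> vU wU.
have [w0|wN0] := eqVneq w 0.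
  left; exists set0, (fun=> 0); split=> //; first exact: sub0set.
    by rewrite cards0.
  by rewrite big_set0.
have [S0|[m mS]] := set_0Vmem S.
  by have [y yw] := exists_neg_functional wN0; right; exists y => // j; rewrite S0 inE.
have S'n : (#|S :\ m| < n)%N by move: leSn; rewrite (cardsD1 m) mS.
have [j||[I [mu [IS dI mu0 wE]]]|[y yv yw]] := IHn v (S :\ m) U w S'n.
- by rewrite inE => /andP[_ /vU].
- by [].
- by left; exists I, mu; split=> //; apply: subset_trans IS (subsetDl _ _).
have [ym0|ym0] := lerP 0 (y (v m)).
  right; exists y => // j jS; have [->//|jm] := eqVneq j m.
  by apply: yv; rewrite !inE jm.
(* The projection along [v m] onto the kernel of [y], possible as [y (v m) < 0]. *)
pose pr x := x - (y x / y (v m)) *: v m.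
have prU x : x \in U -> pr x \in (U :&: lker y)%VS.
  move=> xU; rewrite memv_cap rpredB ?rpredZ ?vU//= memv_ker linearB linearZ /=.
  by rewrite /GRing.scale/= divfK ?subrr ?eqxx// lt_eqF.
have dimK : (\dim (U :&: lker y) < \dim U)%N.
  rewrite (ltn_leqif (dimv_leqif_sup (capvSl _ _))); apply/negP => /subvP/(_ _ (vU m mS)).
  by rewrite memv_cap memv_ker => /andP[_ /eqP y0]; rewrite y0 ltxx in ym0.
have [j||[I [mu [IS dI mu0 wE]]]|[z zv zw]] :=
    IHn (pr \o v) (S :\ m) (U :&: lker y)%VS (pr w) S'n.
- by rewrite inE => /andP[_ /vU /prU].
- exact: prU.
- left; pose c := y w / y (v m) - \sum_(j in I) mu j * (y (v j) / y (v m)).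
  have mI : m \notin I by apply/negP => /(subsetP IS); rewrite !inE eqxx.
  exists (m |: I), (fun j => if j == m then c else mu j); split.
  + by rewrite subUset sub1set mS (subset_trans IS (subsetDl _ _)).
  + by rewrite cardsU1 mI; apply: leq_ltn_trans dimK.
  + move=> j; case: eqP => // _; rewrite subr_ge0 (@le_trans _ _ 0)//.
      apply: sumr_le0 => i /(subsetP IS) iS; rewrite mulr_ge0_le0//.
      by rewrite mulr_ge0_le0 ?yv// invr_le0 ltW.
    by rewrite ltW// nmulr_rgt0// invr_lt0.
  + have -> : w = pr w + (y w / y (v m)) *: v m by rewrite /pr subrK.
    have -> : pr w = \sum_(j in I) mu j *: v j
                     - (\sum_(j in I) mu j * (y (v j) / y (v m))) *: v m.
      rewrite wE scaler_suml -sumrB; apply: eq_bigr => j _.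
      by rewrite /= /pr scalerBr scalerA.
    rewrite big_setU1//= eqxx /c scalerBl [LHS]addrC addrCA addrC; congr (_ + _).
    by apply: eq_bigr => j jI; rewrite ifN//; apply: contraNneq mI => <-.
(* The functional [z \o pr]; it vanishes at [v m]. *)
have zE x : (z - (z (v m) / y (v m)) *: y) x = z (pr x).
  by rewrite subZ_lfunE lfun_subZ mulrAC -mulrA mulrC.
right; exists (z - (z (v m) / y (v m)) *: y); last by rewrite zE.
move=> j jS; rewrite zE; have [->|jm] := eqVneq j m.
  by rewrite /pr divff ?lt_eqF// scale1r subrr linear0.
by apply: zv; rewrite !inE jm.
Qed.

(** * Duality for intersecting convex hulls *)

Section SpreadVector.
Context {R : realFieldType} {V : vectType R} {J : finType}.
Context (h : 'Hom(V, R^o)) (i : J).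

(** The copy of [u] at position [i], minus its average over all positions.  A
    sum of such vectors, with a vector [u_i] for each position [i], has first
    component [0] exactly when all [u_i] are equal; the second component keeps
    track of the total weight. *)
Definition spread (u : V) : {ffun J -> V} * R^o :=
  ([ffun i' => ((i' == i)%:R - #|J|%:R^-1) *: u], h u).

Fact spread_is_linear : linear spread.
Proof.
move=> a u v; congr (_, _); last by rewrite linearP.
by apply/ffunP => i'; rewrite !ffunE scalerDr !scalerA mulrC.
Qed.

HB.instance Definition _ :=
  GRing.isLinear.Build R V ({ffun J -> V} * R^o)%type _ spread spread_is_linear.
End SpreadVector.

Lemma sum_spread (R : realFieldType) (V : vectType R) (J : finType) (h : 'Hom(V, R^o)) u :
  (0 < #|J|)%N -> \sum_(i : J) spread h i u = #|J|%:R *: ((0, h u) : {ffun J -> V} * R^o).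
Proof.
move=> J0; rewrite [LHS]surjective_pairing; congr (_, _); rewrite raddf_sum /=.
  apply/ffunP => i'; rewrite sum_ffunE scaler0 ffunE.
  rewrite (eq_bigr (fun i => (i' == i)%:R *: u - #|J|%:R^-1 *: u)).
    rewrite sumrB sumr_const cardT -cardE -scaler_nat scalerA divff ?pnatr_eq0 ?lt0n_neq0// scale1r.
    rewrite (bigD1 i')//= eqxx scale1r big1 ?addr0 ?subrr// => i ii'.
    by rewrite eq_sym (negPf ii') scale0r.
  by move=> i _; rewrite ffunE scalerBl.
by rewrite sumr_const cardT -cardE -scaler_nat.
Qed.

(** The affine hyperplane [h = 1] stands for the affine space, and the points
    [v k] lie in it.  A point common to the convex hulls of the points
    [v k], [k] in [X i], for all [i], is the same, up to a positive factor, as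
    a conical representation of [(0, 1)] by the vectors [spread h i (v k)], [k] in
    [X i].  If there is none, a functional [f]
    separating [(0, 1)] from them yields the functionals
    [y i = f \o spread h i], nonnegative on [X i], whose sum is a negative
    multiple of [h] since the averages cancel.  Caratheodory in the dual space
    then leaves at most [\dim V] of them with a conical combination equal to a
    negative multiple of [h], so that at each point with [h = 1] one of those is
    negative. *)
Lemma hulls_meet_or_separated (R : realFieldType) (V : vectType R) (h : 'Hom(V, R^o))
    (K J : finType) (v : K -> V) (X : J -> {set K}) :
  (0 < #|J|)%N -> (forall k, h (v k) = 1) ->
  (exists x, h x = 1 /\ forall i, exists2 mu : K -> R,
      forall k, 0 <= mu k & x = \sum_(k in X i) mu k *: v k)
  \/ (exists I : {set J}, exists y : J -> 'Hom(V, R^o),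
      [/\ (#|I| <= \dim {:V})%N, forall i, {in X i, forall k, 0 <= y i (v k)} &
          forall x, h x = 1 -> exists2 i, i \in I & y i x < 0]).
Proof.
move=> J0 hv.
pose W : vectType R := ({ffun J -> V} * R^o)%type.
pose S := [set ik : J * K | ik.2 \in X ik.1].
have [||[I [mu [IS _ mu0 wE]]]|[f fS f0]] :=
    @conic_caratheodory_farkas R W _ (fun ik : J * K => spread h ik.1 (v ik.2))
       S fullv ((0, 1) : W).
- by move=> ? _; exact: memvf.
- exact: memvf.
- left.
  have mu1 : \sum_(ik in I) mu ik = 1.
    move/(congr1 snd): wE; rewrite raddf_sum /= => ->.
    by apply: eq_bigr => ik _; rewrite hv [RHS]mulr1.
  (* The blocks [X i] all contribute the same vector, a fraction [#|J|^-1] of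
     the total; rescaling a block by [#|J|] gives the common point. *)
  exists (\sum_(ik in I) mu ik *: v ik.2); split.
    by rewrite lfun_combination -[RHS]mu1; apply: eq_bigr => ik _; rewrite hv mulr1.
  move=> i; exists (fun k => if (i, k) \in I then #|J|%:R * mu (i, k) else 0).
    by move=> k; case: ifP => // _; rewrite mulr_ge0.
  have := congr1 fst wE; rewrite raddf_sum => /ffunP /(_ i) /=.
  rewrite sum_ffunE !ffunE (eq_bigr (fun ik => (i == ik.1)%:R *: (mu ik *: v ik.2)
     - #|J|%:R^-1 *: (mu ik *: v ik.2))); last first.
    by move=> ik _; rewrite !ffunE -scalerBl !scalerA mulrC.
  rewrite sumrB -scaler_sumr => /esym/eqP; rewrite subr_eq0 => /eqP/esym.
  move=> /(congr1 ( *:%R #|J|%:R)).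
  rewrite scalerA divff ?pnatr_eq0 ?lt0n_neq0// scale1r => ->.
  transitivity (#|J|%:R *: \sum_j \sum_k if (j, k) \in I
    then (i == j)%:R *: (mu (j, k) *: v k) else 0).
    by rewrite pair_bigA big_mkcond; congr (_ *: _); apply: eq_bigr; case.
  rewrite (bigD1 i)//= [X in _ + X]big1 ?addr0; last first.
    move=> j ji; rewrite big1// => k _.
    by rewrite eq_sym (negPf ji) scale0r if_same.
  rewrite eqxx scaler_sumr [RHS]big_mkcond; apply: eq_bigr => k _.
  case: ifPn => ikI; last by rewrite scaler0 scale0r if_same.
  by have /(subsetP IS) := ikI; rewrite inE => ->; rewrite scale1r scalerA.
right.
pose z := f ((0, 1) : W) : R.
pose y i := linfun (f \o spread h i).
have sumY : \sum_i y i = (#|J|%:R * z) *: h.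
  apply/lfunP => u; rewrite sum_lfunE scale_lfunE.
  under eq_bigr do rewrite lfunE /=.
  transitivity (f (\sum_i spread h i u) : R); first by rewrite linear_sum.
  rewrite sum_spread// lfunZ.
  have -> : ((0, h u) : W) = h u *: ((0, 1) : W).
    by congr (_, _); [rewrite scaler0 | rewrite [RHS]mulr1].
  by rewrite lfunZ mulrCA [RHS]mulrC.
have [||[I [mu [_ dI mu0 wE]]]|[g gy g0]] :=
    @conic_caratheodory_farkas R 'Hom(V, R^o) _ y setT fullv (z *: h).
- by move=> ? _; exact: memvf.
- exact: memvf.
- exists I, y; split.
  + have -> : \dim {:V} = \dim {:'Hom(V, R^o)}; last exact: dI.
    by rewrite !dimvf; exact: esym (muln1 _).
  + by move=> i k kX; rewrite lfunE /=; apply: (fS (i, k)); rewrite inE.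
  + move=> x hx.
    have sum_lt0 : \sum_(i in I) mu i * y i x < 0 :> R.
      move/(congr1 (fun g : 'Hom(V, R^o) => g x : R)) : wE.
      rewrite scale_lfunE hx sum_lfunE /GRing.scale/= mulr1 => zE.
      rewrite (eq_bigr (fun i => (mu i *: y i) x)) -?zE// => i _.
      by rewrite scale_lfunE.
    have [/existsP[i /andP[iI yi0]]|/existsPn yN0] :=
      boolP [exists i, (i \in I) && ((y i x : R) < 0)]; first by exists i.
    move: sum_lt0; rewrite ltNge sumr_ge0// => i iI; rewrite mulr_ge0//.
    by have := yN0 i; rewrite iI/= -leNgt.
(* A functional [g] separating [z *: h] from all [y i] cannot exist, because
   [\sum_i y i] is a positive multiple of [z *: h]. *)
have : \sum_i g (y i) < 0 :> R.
  have <- : g (\sum_i y i) = \sum_i g (y i) :> R by rewrite linear_sum.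
  rewrite sumY -scalerA lfunZ.
  by rewrite pmulr_rlt0// ltr0n.
by rewrite ltNge sumr_ge0// => i _; rewrite gy.
Qed.

(** * Traces of halfspaces on a finite set *)

Definition shatters (T : finType) (F : {set {set T}}) (S : {set T}) :=
  [forall B : {set T}, (B \subset S) ==> [exists A in F, A :&: S == B]].

Lemma shattersP (T : finType) (F : {set {set T}}) (S : {set T}) :
  reflect (forall B : {set T}, B \subset S -> exists2 A, A \in F & A :&: S = B)
          (shatters F S).
Proof.
apply: (iffP forallP) => FS B.
  by move=> BS; have /implyP/(_ BS)/exists_inP[A AF /eqP] := FS B; exists A.
by apply/implyP => /FS[A AF AB]; apply/exists_inP; exists A => //; apply/eqP.
Qed.

(** Pajor's strengthening of the Sauer-Shelah lemma.  Split [F] by membership of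
    a point [x] on which two members differ, into [F1] and [F0].  No set
    shattered by [F1] or by [F0] contains [x], and a set [S] shattered by both
    gives a second set [x |: S] shattered by [F]; so the numbers of shattered
    sets of the two halves add up. *)
Lemma card_le_shattered (T : finType) (F : {set {set T}}) :
  (#|F| <= #|[set S : {set T} | shatters F S]|)%N.
Proof.
have [n] := ubnP #|F|; elim: n => // n IHn in F *; rewrite ltnS => Fn.
have [F1|] := leqP #|F| 1.
  have [->|[A AF]] := set_0Vmem F; first by rewrite cards0.
  apply: leq_trans F1 _; rewrite card_gt0; apply/set0Pn; exists set0.
  rewrite inE; apply/shattersP => B; rewrite subset0 => /eqP ->.
  by exists A; rewrite ?setI0.
case/card_gt1P => A0 [B0 [A0F B0F AB]].
have [x xAB] : exists x, (x \in A0) != (x \in B0).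
  apply/existsP; apply: contraNT AB => /existsPn e; apply/eqP/setP => x.
  by have /negPn/eqP := e x.
wlog [xA xB] : A0 B0 A0F B0F AB xAB / x \in A0 /\ x \notin B0.
  move=> wl; case: (boolP (x \in A0)) (xAB) => [xA|xA].
    by case: (boolP (x \in B0)) => // xB _; apply: (wl A0 B0).
  case: (boolP (x \in B0)) => // xB _; apply: (wl B0 A0) => //; by rewrite eq_sym.
pose F1 := [set A in F | x \in A]; pose F0 := [set A in F | x \notin A].
have FE : #|F| = (#|F1| + #|F0|)%N.
  rewrite -(cardsID F1 F); congr (_ + _)%N; apply: eq_card => A; rewrite !inE.
    by rewrite andbA andbb.
  by case: (A \in F); rewrite ?andbF ?andbT.
have F1n : (#|F1| < n)%N.
  apply: leq_trans Fn; rewrite FE -addn1 leq_add2l card_gt0; apply/set0Pn.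
  by exists B0; rewrite inE B0F.
have F0n : (#|F0| < n)%N.
  apply: leq_trans Fn; rewrite FE -add1n leq_add2r card_gt0; apply/set0Pn.
  by exists A0; rewrite inE A0F.
have sh_x (G : {set {set T}}) (S : {set T}) :
    (forall A, A \in G -> x \in A) \/ (forall A, A \in G -> x \notin A) ->
    shatters G S -> x \notin S.
  move=> Gx /shattersP GS; apply/negP => xS; case: Gx => Gx.
    have [A /Gx xA0 A0S] := GS set0 (sub0set _).
    by have := in_set0 x; rewrite -A0S inE xA0 xS.
  have [|A /Gx xA0 AS] := GS [set x]; first by rewrite sub1set.
  by have := set11 x; rewrite -AS inE (negPf xA0).
have F1x S : shatters F1 S -> x \notin S.
  by apply: sh_x; left => A; rewrite inE => /andP[].
have F0x S : shatters F0 S -> x \notin S.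
  by apply: sh_x; right => A; rewrite inE => /andP[].
pose sh (G : {set {set T}}) := [set S : {set T} | shatters G S].
pose both := [set x |: S | S in sh F1 :&: sh F0].
have both_card : #|both| = #|sh F1 :&: sh F0|.
  apply: card_in_imset => S S' /setIP[]; rewrite inE => /F1x xS _ /setIP[].
  rewrite inE => /F1x xS' _ /(congr1 (fun S => S :\ x)).
  by rewrite !setU1K.
have dis : [disjoint (sh F1 :|: sh F0) & both].
  apply/pred0P => S; apply/negbTE/negP => /andP[/setUP SF /imsetP[S' _ SE]].
  have xS : x \in S by rewrite SE setU11.
  by case: SF; rewrite inE; [move/F1x|move/F0x]; rewrite xS.
apply: (@leq_trans #|(sh F1 :|: sh F0) :|: both|).
  rewrite cardsU (disjoint_setI0 dis) cards0 subn0 both_card cardsU subnK.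
    by rewrite FE leq_add ?IHn.
  by rewrite -cardsUI leq_addl.
apply/subset_leq_card/subsetP => S; rewrite !in_setU -orbA => /or3P[||].
- rewrite !inE => /shattersP SF; apply/shattersP => B /SF[A]; rewrite inE => /andP[AF _].
  by exists A.
- rewrite !inE => /shattersP SF; apply/shattersP => B /SF[A]; rewrite inE => /andP[AF _].
  by exists A.
move=> /imsetP[S' /setIP[]]; rewrite !inE => S1 S0 ->; apply/shattersP => B BS.
have xS' := F1x _ S1.
have BS' : B :\ x \subset S' by rewrite subDset.
case: (boolP (x \in B)) => xB'.
  have [A] := shattersP _ _ S1 _ BS'; rewrite inE => /andP[AF xA'] AS'.
  exists A => //; rewrite setIUr AS'; apply/setP => z; rewrite !inE.
  by have [->|] := eqVneq z x; rewrite ?xA' ?xB' //= andbF.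
have [A] := shattersP _ _ S0 _ BS'; rewrite inE => /andP[AF xA'] AS'.
exists A => //; rewrite setIUr AS'; apply/setP => z; rewrite !inE.
by have [->|] := eqVneq z x; rewrite ?(negPf xA') ?(negPf xB') //= andbF.
Qed.

Lemma subset_generating_sum (R : comNzRingType) (K : finType) (t : R) :
  \sum_(S : {set K}) t ^+ #|S| = (1 + t) ^+ #|K|.
Proof.
have := @bigA_distr R 0 1 *%R +%R K (fun=> t) (fun=> 1).
rewrite prodr_const addrC => ->; apply: eq_bigr => S _.
by rewrite -big_mkcond prodr_const.
Qed.

Definition halfspace_traces (R : realFieldType) (V : vectType R) (K : finType) (v : K -> V) :
    {set {set K}} :=
  [set A | `[< exists y : 'Hom(V, R^o), A = [set k | 0 <= y (v k)] >]].

Lemma halfspace_tracesP (R : realFieldType) (V : vectType R) (K : finType) (v : K -> V)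
   (A : {set K}) :
  reflect (exists y : 'Hom(V, R^o), A = [set k | 0 <= y (v k)]) (A \in halfspace_traces v).
Proof. by rewrite inE; exact: asboolP. Qed.

(** Let [c] be the coefficients of a linear relation between the vectors of a
    shattered set, and let the functional [y] be nonnegative exactly where [c]
    is.  In the sum of the [c i * y (v i)], which is [0], all terms are
    nonnegative and those with [c i < 0] are positive.  So no coefficient of a
    relation is negative; applied to [c] and [- c], this shows that the vectors
    are linearly independent. *)
Lemma halfspace_shattered (R : realFieldType) (V : vectType R) (K : finType) (v : K -> V)
    (S : {set K}) :
  shatters (halfspace_traces v) S -> (#|S| <= \dim {:V})%N.
Proof.
move=> /shattersP sh.
pose X := [tuple v (enum_val i) | i < #|S|].
have noneg (c : 'I_#|S| -> R) : \sum_(i < #|S|) c i *: v (enum_val i) = 0 -> forall i, 0 <= c i.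
  move=> c0 i0; rewrite leNgt; apply/negP => ci0.
  have BS : [set enum_val i | i : 'I_#|S| & 0 <= c i] \subset S.
    by apply/subsetP => k /imsetP[i _ ->]; exact: enum_valP.
  have [_ /halfspace_tracesP[y ->] yB] := sh _ BS.
  have yc i : (0 <= y (v (enum_val i)) :> R) = (0 <= c i).
    have /setP/(_ (enum_val i)) := yB; rewrite !inE enum_valP andbT => ->.
    apply/imsetP/idP => [[j]|ci]; first by rewrite inE => cj /enum_val_inj ->.
    by exists i; rewrite ?inE.
  have := lfun_combination y xpredT c (v \o enum_val); rewrite c0 linear0.
  apply/eqP; rewrite lt_eqF// (bigD1 i0)//= ltr_pwDl//.
    by rewrite nmulr_rgt0// ltNge yc -ltNge.
  apply: sumr_ge0 => i _; case: (lerP 0 (c i)) => ci; first by rewrite mulr_ge0// yc.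
  by rewrite ltW// nmulr_rgt0// ltNge yc -ltNge.
have fX : free X.
  apply/freeP => c c0 i.
  have c1 : \sum_i c i *: v (enum_val i) = 0.
    by rewrite -[RHS]c0; apply: eq_bigr => j _; rewrite -tnth_nth tnth_mktuple.
  apply/eqP; rewrite eq_le noneg// andbT -oppr_ge0 (noneg (fun i => - c i))//.
  by under eq_bigr do rewrite scaleNr; rewrite sumrN c1 oppr0.
by have := dimvS (subvf <<X>>); rewrite (eqP fX) size_tuple.
Qed.

(** Weighting a set [S] by [t ^+ #|S|] turns the count of sets of size at most
    [\dim V] into the full sum [(1 + t) ^+ #|K|].  With [t = \dim V / #|K|] this
    is the usual bound [(e n / D) ^ D]. *)
Lemma card_halfspace_traces (R : realType) (V : vectType R) (K : finType) (v : K -> V) (t : R) :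
  0 < t -> t <= 1 ->
  #|halfspace_traces v|%:R * t ^+ (\dim {:V}) <= expR (t * #|K|%:R).
Proof.
move=> t0 t1.
apply: (@le_trans _ _ (\sum_(S in [set S | shatters (halfspace_traces v) S]) t ^+ #|S|)).
  apply: (@le_trans _ _ (\sum_(S in [set S | shatters (halfspace_traces v) S]) t ^+ (\dim {:V}))).
    rewrite sumr_const -[leRHS]mulr_natl; apply: ler_wpM2r.
      by rewrite exprn_ge0// ltW.
    by rewrite ler_nat card_le_shattered.
  apply: ler_sum => S; rewrite inE => /halfspace_shattered dS.
  by rewrite ler_wiXn2l// ltW.
apply: (@le_trans _ _ (\sum_(S : {set K}) t ^+ #|S|)).
  rewrite [leRHS](bigID [in [set S | shatters (halfspace_traces v) S]])/= lerDl.
  by apply: sumr_ge0 => S _; rewrite exprn_ge0// ltW.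
rewrite subset_generating_sum expRM_natr lerXn2r ?nnegrE ?expR_ge0 ?expR_ge1Dx//.
by rewrite addr_ge0// ltW.
Qed.

(** * Families of convex sets without a common point *)

Lemma convex_combination (R : realType) (M : lmodType R) (K : finType) (A : set M)
    (X : {set K}) (p : K -> M) (mu : K -> R) :
  convex_set (M := M) A -> (forall k, k \in X -> A (p k)) -> (forall k, 0 <= mu k) ->
  \sum_(k in X) mu k = 1 -> A (\sum_(k in X) mu k *: p k).
Proof.
move=> Aconv Xp mu0.
(* Points are absorbed one by one into a point [x] of [A] of weight [w]; starting
   from a positive weight avoids division by zero. *)
have avg s x w : 0 < w -> A x -> (forall k, k \in s -> A (p k)) ->
    A ((w + \sum_(k <- s) mu k)^-1 *: (w *: x + \sum_(k <- s) mu k *: p k)).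
  elim: s x w => [|k s IH] x w w0 Ax sA.
    by rewrite !big_nil !addr0 scalerA mulVf ?gt_eqF// scale1r.
  have wk0 : 0 < w + mu k by rewrite ltr_wpDr.
  have := IH ((w + mu k)^-1 *: (w *: x + mu k *: p k)) (w + mu k) wk0.
  rewrite !big_cons scalerA divff ?gt_eqF// scale1r !addrA; apply.
    have t0 : 0 <= w / (w + mu k) by rewrite divr_ge0// ltW.
    have t1 : w / (w + mu k) <= 1 by rewrite ler_pdivrMr// mul1r lerDl.
    have /set_mem := Aconv x (p k) (Itv01 t0 t1) (mem_set Ax)
      (mem_set (sA k (mem_head _ _))).
    congr (A _).
    rewrite -[LHS]/((w / (w + mu k)) *: x + (1 - w / (w + mu k)) *: p k).
    have -> : 1 - w / (w + mu k) = mu k / (w + mu k).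
      by rewrite -[X in X - _](@divff _ (w + mu k)) ?gt_eqF// -mulrBl addrAC subrr add0r.
    by rewrite scalerDr !scalerA ![_^-1 * _]mulrC.
  by move=> j js; apply: sA; rewrite inE js orbT.
move=> mu1.
have [k0 /andP[k0X mk0]] : exists k, (k \in X) && (0 < mu k).
  apply/existsP; apply: contraT => /existsPn muN.
  have := oner_eq0 R; rewrite -mu1 big1 ?eqxx// => k kX.
  by apply/eqP; rewrite eq_le mu0 andbT leNgt; have := muN k; rewrite kX.
have sA k : k \in enum (X :\ k0) -> A (p k) by rewrite mem_enum inE => /andP[_ /Xp].
have := avg (enum (X :\ k0)) (p k0) (mu k0) mk0 (Xp _ k0X) sA.
have e (N : nmodType) (F : K -> N) : F k0 + \sum_(k <- enum (X :\ k0)) F k = \sum_(k in X) F k.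
  by rewrite big_enum -big_setD1.
by rewrite !e mu1 invr1 scale1r.
Qed.

Section AffinePoint.
Context {R : realType} {d : nat}.

Definition affine_lift (x : 'rV[R]_d) : 'rV[R]_d * R^o := (x, 1).
Definition height : 'Hom(('rV[R]_d * R^o)%type, R^o) := linfun snd.

Lemma height_affine_lift x : height (affine_lift x) = 1.
Proof. by rewrite lfunE. Qed.

Lemma dim_affine_lift : \dim {: ('rV[R]_d * R^o)%type} = d.+1.
Proof. by rewrite dimvf -[LHS]/(1 * d + 1)%N mul1n addn1. Qed.
End AffinePoint.

(** The affine form of [hulls_meet_or_separated]: the traces [B i] of [d.+1]
    affine halfspaces suffice, [d.+1] being the dimension of the space that
    contains the affine space as a hyperplane. *)
Lemma convex_sets_meet_or_separated (R : realType) (d r : nat) (K : finType)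
    (p : K -> 'rV[R]_d) (A : 'I_r -> set 'rV[R]_d) (X : 'I_r -> {set K}) :
  (0 < r)%N -> (forall i, convex_set (M := 'rV[R]_d) (A i)) ->
  (forall i k, k \in X i -> A i (p k)) ->
  (exists x, forall i, A i x) \/
  (exists (I : {set 'I_r}) (B : 'I_r -> {set K}),
    [/\ I != set0, (#|I| <= d.+1)%N,
        forall i, B i \in halfspace_traces (affine_lift \o p),
        forall i, X i \subset B i &
        forall k, exists2 i, i \in I & k \notin B i]).
Proof.
move=> r0 Aconv XA.
have [||[x [hx xX]]|[I [y [dI yX yN]]]] :=
  @hulls_meet_or_separated R ('rV[R]_d * R^o)%type height K 'I_r (affine_lift \o p) X.
- by rewrite card_ord.
- by move=> k; exact: height_affine_lift.
- left; exists x.1 => i; have [mu mu0 xE] := xX i.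
  have -> : x.1 = \sum_(k in X i) mu k *: p k by rewrite xE raddf_sum.
  apply: convex_combination => //; first exact: XA.
  move: hx; rewrite lfunE/= xE raddf_sum/= => <-; apply: eq_bigr => k _.
  by rewrite [RHS]mulr1.
right; exists I, (fun i => [set k | 0 <= y i (affine_lift (p k))]); split.
- have [i iI _] := yN (affine_lift 0) (height_affine_lift 0).
  by apply/set0Pn; exists i.
- by rewrite -(@dim_affine_lift R d).
- by move=> i; apply/halfspace_tracesP; exists (y i).
- by move=> i; apply/subsetP => k /yX; rewrite inE.
- move=> k; have [i iI yi] := yN _ (height_affine_lift (p k)).
  by exists i => //; rewrite inE -ltNge.
Qed.

(** * Counting colourings *)

Local Open Scope nat_scope.

(** Every point is outside some region [D w i], and then it cannot receive the
    colour [i] in a colouring compatible with [w]; so [w] is compatible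
    with at most [r.-1 ^ #|K|] colourings. *)
Lemma colouring_cover (r : nat) (K W : finType) (codes : {set W}) (D : W -> 'I_r -> {set K}) :
  (forall chi : {ffun K -> 'I_r}, exists2 w, w \in codes &
      (forall k, k \in D w (chi k)) /\ (forall k, exists i, k \notin D w i)) ->
  r ^ #|K| <= #|codes| * r.-1 ^ #|K|.
Proof.
move=> cover.
pose good w := [forall k, exists i, k \notin D w i].
pose fit w := family (fun k => [pred i | k \in D w i]) : pred {ffun K -> 'I_r}.
have fit_le w : good w -> #|fit w| <= r.-1 ^ #|K|.
  move=> /forallP gw; rewrite card_family /image_mem [#|K|]cardE.
  elim: (enum K) => //= k s IH; rewrite expnS leq_mul//.
  have /existsP[i ki] := gw k.
  rewrite -ltnS prednK; last by case: (r) i {ki} => // -[].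
  rewrite -[X in _ < X]card_ord; apply: (@leq_trans #|'I_r|) => //.
  apply: proper_card; apply/properP; split; first exact/subsetP.
  by exists i.
have -> : r ^ #|K| = \sum_(chi : {ffun K -> 'I_r}) 1.
  by rewrite sum1_card card_ffun card_ord.
apply: (@leq_trans (\sum_(chi : {ffun K -> 'I_r}) \sum_(w in codes | good w && fit w chi) 1)).
  apply: leq_sum => chi _; have [w wc [wchi wgood]] := cover chi.
  rewrite (bigD1 w) ?leq_addr//= wc /=; apply/andP; split.
    by apply/forallP => k; apply/existsP; exact: wgood.
  by apply/familyP => k; rewrite inE.
rewrite (exchange_big_dep (fun w => (w \in codes) && good w))/=; last first.
  by move=> chi w _ /and3P[-> ->].
rewrite -sum_nat_const big_mkcondr/=; apply: leq_sum => w wc.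
case: ifP => // gw; apply: leq_trans (fit_le w gw).
rewrite sum1_card; apply/subset_leq_card/subsetP => chi.
by rewrite !inE => /and3P[].
Qed.

(** The slots [L] are filled with pairs of an index and a member of [F], whose
    number is the first factor.  A relation [bounds l c i a], where [c] is the
    index stored in the slot [l], says that the set stored in [l] is to contain
    the part [a] of colour [i].  The region of colour [i] consists of the points
    lying, for some [a], in all stored sets that bound the part [a].  A point of
    all regions would select a part [j i] for each [i], against the last
    hypothesis. *)
Lemma slot_codes_bound (r : nat) (s : 'I_r -> nat) (K L : finType)
    (bounds : L -> 'I_r -> forall i : 'I_r, 'I_(s i) -> bool) (F : {set {set K}}) :
  (forall chi : {ffun K -> 'I_r}, exists w : L -> 'I_r * {set K},
    [/\ forall l, (w l).2 \in F,
        forall k, exists a, forall l, @bounds l (w l).1 (chi k) a -> k \in (w l).2 &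
        forall (j : forall i, 'I_(s i)) k,
          exists l i, @bounds l (w l).1 i (j i) /\ k \notin (w l).2]) ->
  r ^ #|K| <= (r * #|F|) ^ #|L| * r.-1 ^ #|K|.
Proof.
move=> cover.
pose codes := [set w : {ffun L -> 'I_r * {set K}} |
  w \in ffun_on (setX [set: 'I_r] F)].
pose D (w : {ffun L -> 'I_r * {set K}}) (i : 'I_r) :=
  [set k | [exists a, forall l, @bounds l (w l).1 i a ==> (k \in (w l).2)]].
have -> : (r * #|F|) ^ #|L| = #|codes|.
  by rewrite cardsE card_ffun_on cardsX cardsT card_ord.
apply: (@colouring_cover _ _ _ codes D) => chi.
have [w [wF wX wN]] := cover chi; exists (finfun w).
  by rewrite inE; apply/ffun_onP => l; rewrite ffunE inE in_setT wF.
split=> k.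
  have [a ka] := wX k; rewrite inE; apply/existsP; exists a; apply/forallP => l.
  by apply/implyP; rewrite ffunE => /ka.
apply/existsP; apply: contraT => /existsPn kD.
have /fin_all_exists[j jP] i : exists a, forall l, @bounds l (w l).1 i a -> k \in (w l).2.
  have := kD i; rewrite negbK inE => /existsP[a /forallP ka]; exists a => l.
  by have /implyP := ka l; rewrite ffunE.
by have [l [i [/jP kl /negP]]] := wN j k.
Qed.

(** * Codes for the colourings without Tverberg property *)

Definition avoidable (R : realType) (d r : nat) (s : 'I_r -> nat) (K : finType)
    (p : K -> 'rV[R]_d) (chi : K -> 'I_r) : Prop :=
  exists A : forall i, 'I_(s i) -> set 'rV[R]_d,
    [/\ forall i a, convex_set (M := 'rV[R]_d) (A i a),
        forall k, exists a, A (chi k) a (p k) &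
        ~ exists x, forall i, exists a, A i a x].

Section Codes.
Context {R : realType} {d r : nat} {s : 'I_r -> nat} {K : finType} (p : K -> 'rV[R]_d).
Context (r_gt0 : 0 < r).

Local Notation traces := (halfspace_traces (affine_lift \o p)).

(** A witness that the sets [X i (j i)], [i] in [I], can be enclosed in
    halfspaces with no common point among the points of [p]. *)
Definition certificate (X : forall i, 'I_(s i) -> {set K}) (j : forall i, 'I_(s i))
    (I : {set 'I_r}) (B : 'I_r -> {set K}) : Prop :=
  [/\ forall i, B i \in traces, {in I, forall i, X i (j i) \subset B i} &
      forall k, exists2 i, i \in I & k \notin B i].

Lemma avoidable_certificates chi : avoidable s p chi ->
  exists2 X : forall i, 'I_(s i) -> {set K},
    forall k, exists a, k \in X (chi k) a &
    forall j, exists (I : {set 'I_r}) (B : 'I_r -> {set K}),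
      [/\ I != set0, #|I| <= d.+1 & certificate X j I B].
Proof.
move=> [A [Aconv chiA noA]].
exists (fun i a => [set k | `[< A i a (p k) >]]).
  by move=> k; have [a Aa] := chiA k; exists a; rewrite inE; exact/asboolP.
move=> j.
have [|[x Ax]|[I [B [I0 dI BF XB kB]]]] :=
  @convex_sets_meet_or_separated R d r K p (fun i => A i (j i))
    (fun i => [set k | `[< A i (j i) (p k) >]]) r_gt0 (fun i => Aconv i (j i)).
- by move=> i k; rewrite inE => /asboolP.
- by case: noA; exists x => i; exists (j i).
by exists I, B; split=> //; split=> // i _; exact: XB.
Qed.

(** One block of [minn r d.+1] slots for each tuple [j]; the separated index set
    varies with the colouring, so each slot stores an index besides a trace. *)
Lemma full_tuple_bound :
  (forall chi, avoidable s p chi) ->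
  r ^ #|K| <= (r * #|traces|) ^ (minn r d.+1 * Sprod s) * r.-1 ^ #|K|.
Proof.
move=> bad.
pose L := ({dffun forall i, 'I_(s i)} * 'I_(minn r d.+1))%type.
have <- : #|{: L}| = minn r d.+1 * Sprod s.
  rewrite card_prod card_ord mulnC card_dep_ffun foldrE big_image; congr (_ * _).
  by apply: eq_bigr => i _; rewrite card_ord.
apply: (@slot_codes_bound _ s _ L (fun l c i a => (c == i) && (l.1 i == a))) => chi.
have [X chiX cert] := avoidable_certificates (bad chi).
have /fin_all_exists[g gP] (j : {dffun forall i, 'I_(s i)}) :
  exists g : 'I_(minn r d.+1) -> 'I_r * {set K},
    [/\ forall m, (g m).2 \in traces, forall m, X (g m).1 (j (g m).1) \subset (g m).2 &
     forall k, exists m, k \notin (g m).2].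
  have [I [B [/set0Pn[i0 i0I] dI [BF XB kB]]]] := cert j.
  have le_I : #|I| <= minn r d.+1 by rewrite leq_min dI andbT -[X in _ <= X]card_ord max_card.
  (* An enumeration of [I]; the default value pads it with repetitions. *)
  pose f m := nth i0 (enum I) m.
  have fI m : f m \in I.
    have [lem|lem] := ltnP m #|I|; first by rewrite -mem_enum mem_nth// -cardE.
    by rewrite /f nth_default// -cardE.
  exists (fun m => (f m, B (f m))); split=> [m|m|k] /=; [exact: BF | exact: XB |].
  have [i iI ki] := kB k.
  have idx : index i (enum I) < minn r d.+1.
    by apply: leq_trans le_I; rewrite cardE index_mem mem_enum.
  by exists (Ordinal idx); rewrite /f/= nth_index ?mem_enum.
exists (fun l => g l.1 l.2); split=> [l|k|j k].
- by have [] := gP l.1.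
- have [a ka] := chiX k; exists a => l /andP[/eqP e1 /eqP e2].
  have [_ /(_ l.2) /subsetP sub _] := gP l.1; apply: sub.
  by move: ka; rewrite -e2 -e1.
have [_ _ /(_ k)[m km]] := gP (finfun j).
exists (finfun j, m), (g (finfun j) m).1; split=> //=.
by rewrite eqxx ffunE eqxx.
Qed.

(** A partial tuple assigns [None] outside its domain. *)
Definition partial_domain (j : {dffun forall i, option 'I_(s i)}) : {set 'I_r} :=
  [set i | j i != None].

Definition small_slot (l : {dffun forall i, option 'I_(s i)} * 'I_r) : bool :=
  (l.2 \in partial_domain l.1) && (#|partial_domain l.1| <= d.+1).

Lemma card_partial_tuples (I : {set 'I_r}) :
  #|[pred j | partial_domain j == I]| = \prod_(i in I) s i.
Proof.
pose F (i : 'I_r) := [pred o : option 'I_(s i) | (o != None) == (i \in I)].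
transitivity #|(family F : simpl_pred {dffun forall i, option 'I_(s i)})|.
  apply: eq_card => j; rewrite !inE; apply/eqP/familyP => [jI i|jF].
    by rewrite !inE -jI inE.
  by apply/setP => i; have := jF i; rewrite !inE => /eqP.
rewrite card_family foldrE big_image/= [RHS]big_mkcond; apply: eq_bigr => i _.
case: ifPn => iI.
  rewrite -[RHS]card_ord -[RHS]/(#|'I_(s i)|.+1.-1) -card_option -(cardC1 None).
  by apply: eq_card => o; rewrite !inE unfold_in eqb_id.
rewrite -(card1 (None : option 'I_(s i))); apply: eq_card => o.
by rewrite !inE unfold_in; case: o.
Qed.

Lemma card_small_slots : #|{: {l | small_slot l}}| = Hsum d s.
Proof.
transitivity (\sum_(j : {dffun forall i, option 'I_(s i)} | #|partial_domain j| <= d.+1)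
    #|partial_domain j|).
  rewrite card_sig -sum1_card.
  rewrite (eq_bigl (fun l => (#|partial_domain l.1| <= d.+1)
    && (l.2 \in partial_domain l.1))); last first.
    by move=> l; rewrite inE andbC.
  rewrite -(pair_big_dep (fun j => #|partial_domain j| <= d.+1)
    (fun j i => i \in partial_domain j) (fun _ _ => 1))/=.
  by apply: eq_bigr => j _; rewrite sum1_card.
rewrite (partition_big partial_domain (fun I => #|I| <= d.+1))//=.
rewrite [LHS](bigID (fun I => I != set0))/=.
rewrite [X in _ + X]big1 ?addn0; last first.
  move=> I /andP[_ /negPn/eqP ->]; rewrite big1// => j /andP[_ /eqP ->].
  by rewrite cards0.
apply: eq_big => [I|I /andP[dI _]]; first by rewrite andbC.
rewrite -card_partial_tuples mulnC -sum_nat_const; apply: eq_big => j.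
  by rewrite inE andb_idl// => /eqP ->.
by move=> /andP[_ /eqP ->].
Qed.

(** Slots are indexed by partial tuples, so the index of the bounded part is read
    off the slot.  The witness for a full tuple [j] and its index set [I] only
    involves the restriction of [j] to [I], and is stored there.  Slots of partial
    tuples that need no witness hold the full set, which is a trace. *)
Lemma partial_tuple_bound :
  (forall chi, avoidable s p chi) ->
  r ^ #|K| <= (r * #|traces|) ^ Hsum d s * r.-1 ^ #|K|.
Proof.
move=> bad.
pose L := {l | small_slot l}.
rewrite -card_small_slots.
apply: (@slot_codes_bound _ s _ L
  (fun l _ i a => ((val l).2 == i) && ((val l).1 i == Some a))) => chi.
have [X chiX cert] := avoidable_certificates (bad chi).
have /fin_all_exists[B BP] (j : {dffun forall i, option 'I_(s i)}) :
  exists B : 'I_r -> {set K},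
    [/\ forall i, B i \in traces, forall i a, j i = Some a -> X i a \subset B i &
     forall j' B', (forall i, i \in partial_domain j -> j i = Some (j' i)) ->
       certificate X j' (partial_domain j) B' ->
       forall k, exists2 i, i \in partial_domain j & k \notin B i].
  have [[j' [B' [jj' [B'F B'X B'k]]]]|none] := pselect (exists j' B',
    (forall i, i \in partial_domain j -> j i = Some (j' i)) /\
    certificate X j' (partial_domain j) B').
    exists B'; split=> // i a ja.
    have iI : i \in partial_domain j by rewrite inE ja.
    by have := jj' i iI; rewrite ja => -[->]; exact: B'X.
  exists (fun=> setT); split=> // [i|j' B' jj' cj].
    apply/halfspace_tracesP; exists 0%R; apply/setP => k.
    by rewrite !inE lfunE /= lexx.
  by case: none; exists j', B'.
exists (fun l => ((val l).2, B (val l).1 (val l).2)); split=> [l|k|j k] /=.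
- by have [] := BP (val l).1.
- have [a ka] := chiX k; exists a => l /andP[/eqP e1 /eqP e2].
  have [_ sub _] := BP (val l).1.
  by rewrite e1; apply: (subsetP (sub _ _ e2)).
have [I [B' [_ dI certI]]] := cert j.
pose jI : {dffun forall i, option 'I_(s i)} := [ffun i => if i \in I then Some (j i) else None].
have supI : partial_domain jI = I.
  by apply/setP => i; rewrite inE ffunE; case: (i \in I).
have [_ _ /(_ j B')] := BP jI; rewrite supI => /(_ _ certI k)[i iI|i iI ki].
  by rewrite ffunE iI.
have sl : small_slot (jI, i) by rewrite /small_slot/= supI iI.
exists (exist _ (jI, i) sl), i => /=; split=> //.
by rewrite eqxx ffunE iI eqxx.
Qed.
End Codes.

Local Open Scope ring_scope.

(** * The threshold *)

(** Put [x = n / d.+1].  As [ln r.-1 <= ln r - r^-1], taking logarithms in the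
    counting inequality gives [x <= r T (1 + ln r + ln x)], with [t = x^-1] in
    the bound on [F].  The term [ln x] is absorbed into [x / 2] by the tangent
    inequality [ln x <= x / k - 1 + ln k] with [k = 2 r T]; what remains is
    [x <= 4 r T L], while [x] is at least [5 r T L] if the conclusion fails. *)
Lemma threshold_numerics (R : realType) (r d n T F : nat) (L := ln (expR 1 * r%:R * T%:R) : R) :
  (2 <= r)%N -> (1 <= d)%N -> (1 <= T)%N -> (1 <= F)%N ->
  (forall t : R, 0 < t -> t <= 1 -> F%:R * t ^+ d.+1 <= expR (t * n%:R)) ->
  (r ^ n <= (r * F) ^ T * r.-1 ^ n)%N ->
  n%:R < 10 * d%:R * r%:R * T%:R * L.
Proof.
move=> r2 d1 T1 F1 Fle count.
have r2R : (2 : R) <= r%:R by rewrite ler_nat.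
have d1R : (1 : R) <= d%:R by rewrite ler1n.
have T1R : (1 : R) <= T%:R by rewrite ler1n.
have F1R : (1 : R) <= F%:R by rewrite ler1n.
have r0 : 0 < r%:R :> R by lra.
have T0 : 0 < T%:R :> R by lra.
have F0 : 0 < F%:R :> R by lra.
have rT0 : 0 < r%:R * T%:R :> R by exact: mulr_gt0.
have lnr0 : 0 <= ln r%:R :> R by rewrite ln_ge0//; lra.
have lnT0 : 0 <= ln T%:R :> R by rewrite ln_ge0.
have LE : L = 1 + ln r%:R + ln T%:R.
  by rewrite /L !lnM ?posrE ?expR_gt0 ?mulr_gt0 ?expR_gt0// expRK.
rewrite ltNge; apply/negP => nbig.
set D : R := d.+1%:R.
have DE : D = d%:R + 1 by rewrite /D -natr1.
have D0 : 0 < D by rewrite ltr0n.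
have rT1 : 1 <= r%:R * T%:R :> R by rewrite mulr_ege1//; lra.
have L1 : 1 <= L by rewrite LE; lra.
have rTL1 : 1 <= r%:R * T%:R * L by rewrite mulr_ege1.
pose x := n%:R / D.
have xbig : 5 * (r%:R * T%:R * L) <= x.
  rewrite /x ler_pdivlMr//; apply: le_trans nbig.
  have : 0 <= (r%:R * T%:R * L) * (d%:R - 1) by rewrite mulr_ge0// ?subr_ge0//; lra.
  rewrite DE; lra.
have x0 : 0 < x by lra.
have nE : n%:R = x * D by rewrite /x divfK ?gt_eqF.
have lnF : ln F%:R <= D * (1 + ln x).
  have := Fle x^-1; rewrite invr_gt0 x0 invf_le1// => /(_ isT).
  have -> : 1 <= x by lra.
  move=> /(_ isT); rewrite nE mulKf ?gt_eqF//.
  rewrite -ler_ln ?posrE ?expR_gt0 ?mulr_gt0 ?exprn_gt0 ?invr_gt0//.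
  rewrite expRK lnM ?posrE ?exprn_gt0 ?invr_gt0// lnXn ?invr_gt0// lnV ?posrE//.
  by rewrite -[_ *+ _]mulr_natr -/D; lra.
have r1 : (0 : R) < r.-1%:R by rewrite ltr0n -subn1 subn_gt0.
have lnr1 : ln r.-1%:R <= ln r%:R - r%:R^-1 :> R.
  have -> : r.-1%:R = r%:R * (1 - r%:R^-1) :> R.
    by rewrite mulrBr mulr1 divff ?gt_eqF// -subn1 natrB ?(ltnW r2).
  have ri : r%:R^-1 <= 2^-1 :> R by rewrite lef_pV2 ?posrE.
  rewrite lnM ?posrE//; last by rewrite subr_gt0; lra.
  by rewrite lerD2l; apply: le_ln1Dx; lra.
have main : x <= r%:R * T%:R * (1 + ln r%:R + ln x).
  have : n%:R * ln r%:R <= T%:R * (ln r%:R + ln F%:R) + n%:R * ln r.-1%:R :> R.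
    have : (r ^ n)%:R <= ((r * F) ^ T * r.-1 ^ n)%:R :> R by rewrite ler_nat.
    rewrite natrM !natrX natrM -ler_ln ?posrE ?mulr_gt0 ?exprn_gt0 ?mulr_gt0//.
    rewrite lnM ?posrE ?exprn_gt0 ?mulr_gt0// !lnXn ?mulr_gt0// lnM ?posrE//.
    by rewrite -[ln r%:R *+ _]mulr_natl -[_ *+ T]mulr_natl -[ln _ *+ n]mulr_natl.
  move=> h.
  have h2 : n%:R * r%:R^-1 <= T%:R * (ln r%:R + D * (1 + ln x)).
    have := ler_wpM2l (ler0n R n) lnr1; have := ler_wpM2l (ltW T0) lnF.
    rewrite mulrBr !mulrDr; move: h; rewrite !mulrDr; lra.
  have h3 : n%:R * r%:R^-1 <= T%:R * (D * (1 + ln r%:R + ln x)).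
    apply: le_trans h2 _; rewrite ler_pM2l//.
    have : ln r%:R <= D * ln r%:R by rewrite ler_peMl// /D ler1n.
    rewrite !mulrDr; lra.
  rewrite -(ler_pM2r D0) -nE; move: h3; rewrite ler_pdivrMr//.
  by congr (_ <= _); ring.
pose k : R := 2 * (r%:R * T%:R).
have k0 : 0 < k by rewrite /k; lra.
have lnx : ln x <= x / k - 1 + ln k.
  have xk0 : 0 < x / k by exact: divr_gt0.
  rewrite -lerBlDr -ln_div ?posrE//.
  have /le_ln1Dx : -1 < x / k - 1 by lra.
  by rewrite addrC subrK.
have lnk : ln k <= 1 + ln r%:R + ln T%:R.
  have ln2 : ln 2 <= 1 :> R.
    by have := @le_ln1Dx R 1; rewrite (_ : 1 + 1 = 2 :> R)//; apply; lra.
  rewrite /k !lnM ?posrE//; lra.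
have xk : x / k * (r%:R * T%:R) = x / 2.
  by rewrite /k; field; rewrite !gt_eqF.
have : x <= r%:R * T%:R * (1 + ln r%:R + (x / k - 1 + ln k)).
  by apply: le_trans main _; rewrite ler_pM2l// lerD2l.
have -> : r%:R * T%:R * (1 + ln r%:R + (x / k - 1 + ln k)) =
   x / k * (r%:R * T%:R) + r%:R * T%:R * (ln r%:R + ln k) by ring.
rewrite xk => hx.
have : r%:R * T%:R * (ln r%:R + ln k) <= r%:R * T%:R * (2 * L).
  by rewrite ler_pM2l// LE; lra.
lra.
Qed.

Lemma Tmin_gt0 (d r : nat) (s : 'I_r -> nat) :
  (0 < r)%N -> (forall i, (1 <= s i)%N) -> (0 < Tmin d s)%N.
Proof.
move=> r0 s0; rewrite /Tmin leq_min muln_gt0 leq_min r0 /= prodn_gt0//=.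
rewrite /Hsum (bigD1 [set Ordinal r0])/= ?ltn_addr// ?cards1 ?mul1n ?big_set1//.
by rewrite andbT; apply/set0Pn; exists (Ordinal r0); rewrite inE.
Qed.

Lemma unavoidable_colouring (R : realType) (d r : nat) (s : 'I_r -> nat) (K : finType)
    (p : K -> 'rV[R]_d) :
  (2 <= r)%N -> (1 <= d)%N -> (forall i, (1 <= s i)%N) ->
  10 * d%:R * r%:R * (Tmin d s)%:R * ln (expR 1 * r%:R * (Tmin d s)%:R) <= #|K|%:R :> R ->
  exists chi : K -> 'I_r, ~ avoidable s p chi.
Proof.
move=> r2 d1 s1 Kbig; apply: contrapT => /forallNP bad.
have {}bad chi : avoidable s p chi by apply: contrapT; exact: bad.
have r0 : (0 < r)%N by apply: leq_trans r2.
pose F := #|halfspace_traces (affine_lift \o p)|.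
suff : #|K|%:R < 10 * d%:R * r%:R * (Tmin d s)%:R * ln (expR 1 * r%:R * (Tmin d s)%:R) :> R.
  by rewrite ltNge Kbig.
apply: (@threshold_numerics R r d #|K| (Tmin d s) F) => //.
- exact: Tmin_gt0.
- rewrite card_gt0; apply/set0Pn; exists [set: K]; apply/halfspace_tracesP; exists 0.
  by apply/setP => k; rewrite !inE lfunE /= lexx.
- by move=> t t0 t1; rewrite -(@dim_affine_lift R d); exact: card_halfspace_traces.
rewrite /Tmin /minn; case: ifP => _; first exact: full_tuple_bound.
exact: partial_tuple_bound.
Qed.

(** An empty class would also make the colouring avoidable, by taking no point at
    all for that colour and everything for the others. *)
Lemma tverberg_partition_of_colouring (R : realType) (d r : nat) (s : 'I_r -> nat)
    (P : {fset 'rV[R]_d}) (chi : P -> 'I_r) :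
  (forall i, (1 <= s i)%N) -> ~ avoidable s (val : P -> 'rV[R]_d) chi ->
  tverberg_partition s [set` P]%classic
    (fun i => [set x | exists2 k : P, chi k = i & x = val k]%classic).
Proof.
move=> s1 chiN; split; first split.
- apply/seteqP; split=> x /=.
    by move=> [i _ [k _ ->]]; exact: valP.
  by move=> xP; exists (chi [` xP]%fset) => //; exists [` xP]%fset.
- by move=> i j _ _ [x [[k <- ->] [k' <- /val_inj ->]]].
- move=> i _; apply: contrapT => Qi0; apply: chiN.
  exists (fun i' _ => [set x | i' != i]%classic); split.
  + by move=> i' _ x y t; rewrite !classical_sets.inE.
  + move=> k; exists (Ordinal (s1 (chi k))) => /=; apply/eqP => ki; apply: Qi0.
    by exists (val k), k.
  + by move=> [x /(_ i)[_ /=]]; rewrite eqxx.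
move=> C CQ; apply: contrapT => C0; apply: chiN.
have /fin_all_exists[A AP] i := (CQ i).1.
exists A; split.
- by move=> i a; have [Ac _] := AP i; exact: Ac.
- move=> k; have [_ CE] := AP (chi k).
  have : C (chi k) (val k) by apply: (CQ (chi k)).2; exists k.
  by rewrite CE => -[a _ Aa]; exists a.
move=> [x Ax]; apply: C0; exists x => i _; have [_ ->] := AP i.
by have [a Aa] := Ax i; exists a.
Qed.

Theorem theorem1p4 (R : realType) :
  exists c : R,
    forall (r d : nat) (s : 'I_r -> nat),
      (2 <= r)%N -> (1 <= d)%N -> (forall i, (1 <= s i)%N) ->
      exists N : nat,
        is_tverberg_number R d s N /\
        N%:R <= c * d%:R * r%:R * (Tmin d s)%:R
                * ln (expR 1 * r%:R * (Tmin d s)%:R).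
Proof.
(* One unit above the constant of [unavoidable_colouring] pays for rounding down:
   [bound - 1] is still at least [10] times the base quantity, which is [>= 1]. *)
exists 11 => r d s r2 d1 s1.
have T0 := Tmin_gt0 d (ltnW r2) s1.
set L := ln _; set bound := _ * L.
have L1 : 1 <= L.
  rewrite -[leLHS]expRK ler_ln ?posrE ?mulr_gt0 ?expR_gt0 ?ltr0n ?(ltnW r2)//.
  by rewrite -mulrA ler_peMr ?expR_ge0// mulr_ege1 ?ler1n ?(ltnW r2).
have W1 : 1 <= d%:R * r%:R * (Tmin d s)%:R * L.
  by rewrite !mulr_ege1 ?ler1n ?(ltnW r2).
have boundE : bound = 11 * (d%:R * r%:R * (Tmin d s)%:R * L) by rewrite /bound; ring.
have bound0 : 0 <= bound by rewrite boundE; lra.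
have /andP[N_le N_gt] := truncn_itv bound0.
have N_threshold : tverberg_threshold R d s (Num.truncn bound).
  move=> P /finite_fsetP[X ->] leP.
  have leX : (Num.truncn bound <= #|{: X}|)%N.
    have /card_le_eqr XE : ([set` X]%classic #= `I_#|{: X}|)%card.
      by apply/card_eq_fsetP; rewrite cardfE.
    by rewrite -card_le_II -XE.
  have [|chi chiN] := @unavoidable_colouring R d r s X val r2 d1 s1.
    have : (Num.truncn bound).+1%:R <= #|{: X}|.+1%:R :> R by rewrite ler_nat.
    move: N_gt; rewrite -/L -[in #|_|.+1%:R]natr1 boundE; lra.
  by eexists; apply: tverberg_partition_of_colouring chiN.
have exN : exists N, `[< tverberg_threshold R d s N >].
  by exists (Num.truncn bound); apply/asboolP.
exists (ex_minn exN); case: ex_minnP => N /asboolP NT Nmin; split.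
  by split=> // M MT; apply: Nmin; apply/asboolP.
apply: le_trans N_le; rewrite ler_nat; apply: Nmin; exact/asboolP.
Qed.
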